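(* Let $H$ be a Hilbert space and let $A$ be a closed linear operator in $H$ with domain of definition $D(A)=H$. Then the adjoint operator $A^*$ satisfies $D(A^* )=H$.
   Context: $D(A)$ denotes the domain of definition of the operator $A$, and $(u,v)$ denotes the inner product in $H$. A linear operator $A$ in $H$ is called closed if, whenever $u_n\in D(A)$, $u_n\to u$ and $Au_n\to v$ in $H$, it follows that $u\in D(A)$ and $Au=v$. The adjoint $A^*$ of a densely defined linear operator $A$ has domain $D(A^* )$ consisting of all $v\in H$ for which there exists $v^*\in H$ with $(Au,v)=(u,v^* )$ for all $u\in D(A)$; in that case $A^*v=v^*$. *)

(* Defs.v *)
From HB Require Import structures.
From mathcomp Require Import all_boot all_order all_algebra.
From mathcomp Require Import complex.
From mathcomp Require Import boolp classical_sets functions reals.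
From mathcomp Require Import topology normedtype.
Set Implicit Arguments.
Unset Strict Implicit.
Unset Printing Implicit Defensive.
Import Order.TTheory GRing.Theory Num.Theory.
Import numFieldNormedType.Exports.
Local Open Scope classical_set_scope.
Local Open Scope ring_scope.

(* The scalar field of a Hilbert space is either R or the complex numbers
   R[i]; a statement quantified over [scalar_kind] covers both cases. *)
Variant scalar_kind := RealScalars | ComplexScalars.

Definition scalar (R : realType) (k : scalar_kind) : numFieldType :=
  match k with
  | RealScalars => R
  | ComplexScalars => R[i]
  end.

Definition conjugation (R : realType) (k : scalar_kind) :
    involutive_rmorphism (scalar R k) :=
  match k return involutive_rmorphism (scalar R k) with
  | RealScalars => @idfun R
  | ComplexScalars => @Num.conj R[i]
  end.

HB.mixin Record NormedModule_isPreHilbert (K : numFieldType)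
    (theta : involutive_rmorphism K) H of NormedModule K H := {
  inner_subdef : {dot H for theta};
  inner_norm_subproof : forall x : H, `|x| ^+ 2 = inner_subdef x x
}.

#[short(type="hilbertType")]
HB.structure Definition Hilbert (K : numFieldType)
    (theta : involutive_rmorphism K) :=
  {H of CompleteNormedModule K H & NormedModule_isPreHilbert K theta H}.

Section Inner.
Variables (K : numFieldType) (theta : involutive_rmorphism K).
Variable H : hilbertType theta.

(* [inner] is linear in its first argument and [theta]-linear in its second. *)
Definition inner : {dot H for theta} := @inner_subdef K theta H.

Lemma inner_norm (x : H) : `|x| ^+ 2 = inner x x.
Proof. exact: inner_norm_subproof. Qed.

End Inner.

Section Operators.
Variables (K : numFieldType) (H : normedModType K).

(* The values of [op] outside [dom] are irrelevant. *)
Record linear_operator := LinearOperator {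
  dom : set H;
  op :> H -> H;
  dom0 : dom 0;
  dom_linear : forall a u v, dom u -> dom v -> dom (a *: u + v);
  op_linear : forall a u v, dom u -> dom v ->
    op (a *: u + v) = a *: op u + op v
}.

Definition closed_operator (A : linear_operator) :=
  forall (u_ : nat -> H) (u v : H), (forall n, dom A (u_ n)) ->
    u_ n @[n --> \oo] --> u -> A (u_ n) @[n --> \oo] --> v ->
    dom A u /\ A u = v.

Definition densely_defined (A : linear_operator) := dense (dom A).

Lemma densely_definedT A : dom A = setT -> densely_defined A.
Proof. by move=> AT O [x Ox] _; exists x; rewrite AT. Qed.

End Operators.

Section Adjoint.
Variables (K : numFieldType) (theta : involutive_rmorphism K).
Variables (H : hilbertType theta) (A : linear_operator H).

Definition adjoint_rel (v w : H) :=
  forall u, dom A u -> inner H (A u) v = inner H u w.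

Definition adjoint_dom : set H := [set v | exists w, adjoint_rel v w].

Definition adjoint_op (v : H) : H := xget 0 [set w | adjoint_rel v w].

Lemma adjoint_opP v : adjoint_dom v -> adjoint_rel v (adjoint_op v).
Proof. by case=> w vw; exact: (xgetPex 0 (ex_intro _ w vw)). Qed.

Lemma adjoint_rel0 : adjoint_rel 0 0.
Proof. by move=> u _; rewrite !linear0r. Qed.

Lemma adjoint_rel_linear a v1 v2 w1 w2 : adjoint_rel v1 w1 ->
  adjoint_rel v2 w2 -> adjoint_rel (a *: v1 + v2) (a *: w1 + w2).
Proof.
by move=> h1 h2 u Au; rewrite !linearDr !linearZr_LR /= h1 // h2.
Qed.

Hypothesis densA : densely_defined A.

Lemma dense_orthogonal w : (forall u, dom A u -> inner H u w = 0) -> w = 0.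
Proof.
move=> w_orth; apply/eqP; apply: contraT => w_neq0.
have w_gt0 : 0 < `|w| by rewrite normr_gt0.
have [] := densA (O := ball w `|w|).
- by exists w; exact: ballxx.
- exact: ball_open.
move=> x []; rewrite -ball_normE /= => wx Ax.
have wx0 : inner H w x = 0.
  by rewrite hermC /= w_orth// rmorph0 mulr0.
suff : `|w| ^+ 2 <= `|w - x| ^+ 2.
  by rewrite ler_pXn2r ?nnegrE// => /(lt_le_trans wx); rewrite ltxx.
have /= Dwx := hnormBd (form := inner H) wx0.
by rewrite !inner_norm Dwx lerDl -inner_norm exprn_ge0.
Qed.

Lemma adjoint_rel_unique v w1 w2 :
  adjoint_rel v w1 -> adjoint_rel v w2 -> w1 = w2.
Proof.
move=> h1 h2; apply/eqP; rewrite -subr_eq0; apply/eqP.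
by apply: dense_orthogonal => u Au; rewrite linearBr /= -h1// -h2// subrr.
Qed.

Lemma adjoint_dom0 : adjoint_dom 0.
Proof. by exists 0; exact: adjoint_rel0. Qed.

Lemma adjoint_dom_linear a u v :
  adjoint_dom u -> adjoint_dom v -> adjoint_dom (a *: u + v).
Proof.
by move=> [u' hu] [v' hv]; exists (a *: u' + v'); exact: adjoint_rel_linear.
Qed.

Lemma adjoint_op_linear a u v : adjoint_dom u -> adjoint_dom v ->
  adjoint_op (a *: u + v) = a *: adjoint_op u + adjoint_op v.
Proof.
move=> hu hv; apply: (@adjoint_rel_unique (a *: u + v)).
  exact/adjoint_opP/adjoint_dom_linear.
by apply: adjoint_rel_linear; exact: adjoint_opP.
Qed.

Definition adjoint : linear_operator H :=
  LinearOperator adjoint_dom0 adjoint_dom_linear adjoint_op_linear.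

Lemma adjointE v w : adjoint_rel v w -> adjoint v = w.
Proof.
by move=> vw; apply: (@adjoint_rel_unique v) => //; apply: adjoint_opP; exists w.
Qed.

End Adjoint.

(* Main.v *)
(** The domain D of the adjoint is shown to be closed and to have trivial
    orthogonal complement.
    - On the graph of [A], a Hilbert space because [A] is closed, the Riesz
      theorem represents [(z, A z) |-> (A z, c)] by some [(u, A u)]; hence
      [w = c - A u] lies in D and [A^* w = u].  If [c] is orthogonal to D then
      [0 = (w, c) = |w|^2 + (w, A u) = |w|^2 + |u|^2], so [c = 0].
    - Pointwise [|(z, A^* v)| = |(A z, v)| <= |A z|] for [|v| <= 1], so by uniform
      boundedness [|A^* v| <= C |v|] on D, and D is closed. *)
Require Import Defs.
From HB Require Import structures.
From mathcomp Require Import all_boot all_order all_algebra.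
From mathcomp Require Import boolp classical_sets reals topology normedtype.
From mathcomp Require Import complex ring.
Import Order.TTheory GRing.Theory Num.Theory.
Import numFieldNormedType.Exports.
Local Open Scope classical_set_scope.
Local Open Scope ring_scope.
Set Implicit Arguments.
Unset Strict Implicit.
Unset Printing Implicit Defensive.

(** * Order properties shared by the real and complex scalars *)

Section Scalars.
Variables (R : realType) (k : scalar_kind).
Local Notation K := (Defs.scalar R k).
Local Notation theta := (conjugation R k).

Lemma mul_conjugation (c : K) : c * theta c = `|c| ^+ 2.
Proof.
case: k c => c /=; first by rewrite real_normK ?num_real.
by rewrite normCK.
Qed.

Lemma scalar_archi (x : K) : 0 <= x -> exists n : nat, x <= n%:R.
Proof.
case: k x => /= x x0; first by exists (Num.truncn x).+1; rewrite ltW// truncnS_gt.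
exists (Num.truncn (complex.Re x)).+1.
have /RRe_real <- : x \is Num.real by rewrite ger0_real.
by rewrite -(rmorph_nat (real_complex R)) lecR ltW// truncnS_gt.
Qed.

(** In [R[i]] a nonnegative element is real, so the set is the image of a set of reals bounded
    below, and the real infimum transfers. *)
Lemma scalar_inf (E : set K) : E !=set0 -> (forall x, E x -> 0 <= x) ->
  exists m, (forall x, E x -> m <= x) /\
    forall e, 0 < e -> exists2 x, E x & x <= m + e.
Proof.
case: k E => /= E E0 Ege0.
  have infE : has_inf E by split=> //; exists 0 => x /Ege0.
  exists (inf E); split=> [x Ex|e e0]; first exact: ge_inf infE.2 _ Ex.
  by have [x Ex /ltW xe] := inf_adherent e0 infE; exists x.
pose F := [set x : R | E (real_complex R x)].
have ReE x : E x -> real_complex R (complex.Re x) = x.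
  by move=> /Ege0 x0; rewrite RRe_real// ger0_real.
have infF : has_inf F.
  split; first by case: E0 => x Ex; exists (complex.Re x); rewrite /F /= ReE.
  by exists 0 => x /Ege0; rewrite ler0c.
exists (real_complex R (inf F)); split=> [x Ex|e e0].
  by rewrite -(ReE x Ex) lecR; apply: ge_inf infF.2 _ _; rewrite /F /= ReE.
have eE : real_complex R (complex.Re e) = e by rewrite RRe_real// gtr0_real.
rewrite -eE in e0 *; rewrite ltcR in e0.
have [x Fx /ltW xe] := inf_adherent e0 infF.
by exists (real_complex R x) => //; rewrite -rmorphD lecR.
Qed.

End Scalars.

Lemma ler_norm_sqrB (K : numFieldType) (x y : K) :
  `|x - y| ^+ 2 <= 2 * `|x| ^+ 2 + 2 * `|y| ^+ 2.
Proof.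
apply: (@le_trans _ _ ((`|x| + `|y|) ^+ 2)).
  by rewrite ler_pXn2r ?nnegrE ?addr_ge0 ?ler_normB.
rewrite -subr_ge0 (_ : _ - _ = (`|x| - `|y|) ^+ 2); last by ring.
by rewrite real_exprn_even_ge0// rpredB// normr_real.
Qed.

Lemma le0_small (K : numFieldType) (a C : K) :
  0 <= a -> 0 <= C -> (forall e, 0 < e -> a <= C * e) -> a = 0.
Proof.
move=> a0 C0 aC; apply/eqP; apply: contraT => aN0.
have {a0 aN0} a0 : 0 < a by rewrite lt_def aN0.
(* Testing with [e = a / (C + 1)] would give [a <= a * C / (C + 1) < a]; the [+ 1] covers
   [C = 0]. *)
have C1 : 0 < C + 1 by rewrite ltr_wpDl.
have := aC (a / (C + 1)) (divr_gt0 a0 C1).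
by rewrite mulrCA ler_pMr// ler_pdivlMr// mul1r gerDl ler10.
Qed.

(** * Inner-product geometry and Riesz representation *)

Section Dot.
Variables (K : numFieldType) (theta : involutive_rmorphism K).
Hypothesis mulJ : forall c, c * theta c = `|c| ^+ 2.

Lemma ge0_conjugation (c : K) : 0 <= c -> theta c = c.
Proof.
have [->|c0 cp] := eqVneq c 0; first by rewrite rmorph0.
by apply: (mulfI c0); rewrite mulJ ger0_norm.
Qed.

Variables (V : lmodType K) (g : {dot V for theta}).

Lemma dotC x y : g x y = theta (g y x).
Proof. by rewrite hermC mul1r. Qed.

Lemma dot_ge0 x : 0 <= g x x.
Proof.
by have [->|/neq0_dnorm_gt0-/(_ theta g)/ltW//] := eqVneq x 0; rewrite linear0r.
Qed.

Lemma parallelogram x y :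
  g (x - y) (x - y) + g (x + y) (x + y) = 2 * g x x + 2 * g y y.
Proof.
by rewrite linearBl !linearBr linearDl !linearDr /=; ring.
Qed.

(* For [m = 0] this is the Cauchy-Schwarz inequality; for [x] almost minimising
   the norm over [x + K z], it says that [x] is almost orthogonal to [z]. *)
Lemma almost_minimal_orthogonal x z m e :
  (forall t, m <= g (x + t *: z) (x + t *: z)) -> g x x <= m + e ->
  `|g z x| ^+ 2 <= e * g z z.
Proof.
move=> mx xe; have [->|z0] := eqVneq z 0.
  by rewrite linear0l normr0 expr0n/= linear0r mulr0.
have p0 := neq0_dnorm_gt0 (s := g) z z0; set p := g z z in p0 *.
have pN0 : p != 0 by rewrite gt_eqF.
rewrite -ler_pdivrMr// -mulJ; set c := g z x.
have tE : theta (- (theta c / p)) = - (c / p).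
  by rewrite rmorphN fmorph_div /= (rmorphK theta c) (ge0_conjugation (ltW p0)).
(* This [t] minimises the quadratic [g (x + t *: z) (x + t *: z)]; the minimum is
   [g x x - |c|^2 / p]. *)
have := mx (- (theta c / p)).
rewrite linearDl !linearDr /= !linearZl_LR /= !linearZr_LR /= (dotC x z) -/c -/p.
rewrite tE => mt.
rewrite -subr_ge0.
have -> : e - c * theta c / p = (g x x + - (c / p) * theta c
    + (- (theta c / p) * c + - (theta c / p) * (- (c / p) * p)) - m)
    + (m + e - g x x) by field.
by rewrite addr_ge0// subr_ge0.
Qed.

Lemma cauchy_schwarz x y : `|g x y| ^+ 2 <= g x x * g y y.
Proof.
rewrite mulrC; apply: (@almost_minimal_orthogonal _ _ 0); last by rewrite add0r.
by move=> t; exact: dot_ge0.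
Qed.

(** Squared distances are measured by the form itself, so any form on [V] can be used and no square
    roots are taken in [K]. *)
Definition dot_cvg (s : nat -> V) l := forall e, 0 < e ->
  exists N, forall n, (N <= n)%N -> g (s n - l) (s n - l) <= e.

Definition dot_cauchy (s : nat -> V) := forall e, 0 < e ->
  exists N, forall n m, (N <= n)%N -> (N <= m)%N ->
    g (s n - s m) (s n - s m) <= e.

Definition dot_complete (S : set V) := forall s, (forall n, S (s n)) ->
  dot_cauchy s -> exists2 l, S l & dot_cvg s l.


Hypothesis archiK : forall x : K, 0 <= x -> exists n : nat, x <= n%:R.
Hypothesis infK : forall E : set K, E !=set0 -> (forall x, E x -> 0 <= x) ->
  exists m, (forall x, E x -> m <= x) /\
    forall e, 0 < e -> exists2 x, E x & x <= m + e.

Lemma archi_inv (e : K) : 0 < e -> exists N : nat,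
  forall n, (N <= n)%N -> n.+1%:R^-1 <= e.
Proof.
move=> e0; have [N eN] : exists n : nat, e^-1 <= n%:R.
  by apply: archiK; rewrite invr_ge0 ltW.
exists N => n Nn; rewrite invf_ple ?posrE//.
by apply: le_trans eN _; rewrite ler_nat ltnW.
Qed.

(* The representing vector is a multiple of the element of minimal norm in the
   affine subspace [f = 1]. *)
Lemma riesz (S : set V) (f : V -> K) (C : K) : S 0 ->
  (forall a u v, S u -> S v -> S (a *: u + v)) -> dot_complete S ->
  (forall a u v, S u -> S v -> f (a *: u + v) = a * f u + f v) ->
  0 <= C -> (forall u, S u -> `|f u| ^+ 2 <= C * g u u) ->
  exists2 w, S w & forall u, S u -> f u = g u w.
Proof.
move=> S0 Slin Scomp flin C0 fC.
have SZ a u : S u -> S (a *: u) by move=> Su; rewrite -[_ *: _]addr0; exact: Slin.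
have f0 : f 0 = 0.
  by have := flin (-1) 0 0 S0 S0; rewrite scaler0 addr0 mulN1r addNr.
have fZ a u : S u -> f (a *: u) = a * f u.
  by move=> Su; have := flin a u 0 Su S0; rewrite f0 !addr0.
have [[u0 Su0 fu0]|nf] := pselect (exists2 u, S u & f u != 0); last first.
  exists 0 => // u Su; rewrite linear0r; apply/eqP; apply: contraT => fu.
  by case: nf; exists u.
pose D := [set u | S u /\ f u = 1].
have Dtran u z t : D u -> S z -> f z = 0 -> D (u + t *: z).
  move=> [Su fu] Sz fz; split; first by rewrite addrC; exact: Slin.
  by rewrite addrC flin// fz mulr0 add0r.
have [|_ [u _ <-]|m [mD Dm]] := @infK [set g u u | u in D].
- exists (g ((f u0)^-1 *: u0) ((f u0)^-1 *: u0)), ((f u0)^-1 *: u0) => //.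
  by split; [exact: SZ|rewrite fZ// mulVf].
- exact: dot_ge0.
have {}mD u : D u -> m <= g u u by move=> Du; apply: mD; exists u.
have /choice[s sP] (n : nat) : exists u, D u /\ g u u <= m + n.+1%:R^-1.
  have [|_ [u Du <-] um] := Dm n.+1%:R^-1; first by rewrite invr_gt0.
  by exists u.
have Ds n : D (s n) := (sP n).1.
have sm n : g (s n) (s n) <= m + n.+1%:R^-1 := (sP n).2.
have [|e e0|l Sl sl] := Scomp s; first by move=> n; case: (Ds n).
  (* Midpoints stay in [D], so [g (s i + s j) (s i + s j) >= 4 m]; the parallelogram law then bounds
     the squared distance of [s i] and [s j] by [2 / (i + 1) + 2 / (j + 1)]. *)
  have [|N Ne] := @archi_inv (e / 4); first by rewrite divr_gt0.
  exists N => i j Ni Nj.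
  have mid : D (2^-1 *: (s i + s j)).
    have [[Si fi] [Sj fj]] := (Ds i, Ds j).
    have Sij : S (s i + s j) by rewrite -[s i]scale1r; exact: Slin.
    split; first exact: SZ.
    rewrite fZ//.
    have := flin 1 _ _ Si Sj; rewrite scale1r mul1r fi fj => ->.
    by rewrite mulVf// pnatr_eq0.
  have : 4 * m <= g (s i + s j) (s i + s j).
    have := mD _ mid; rewrite linearZl_LR linearZr_LR /=.
    rewrite ge0_conjugation ?invr_ge0// mulrA -invfM -natrM.
    by rewrite ler_pdivlMl.
  have /eqP := parallelogram (s i) (s j); rewrite eq_sym -subr_eq => /eqP <-.
  move: (sm i) (sm j) (Ne _ Ni) (Ne _ Nj); rewrite -subr_ge0 => si.
  rewrite -subr_ge0 => sj; rewrite -subr_ge0 => ei; rewrite -subr_ge0 => ej.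
  rewrite -subr_ge0 => ij; rewrite -subr_ge0.
  set a := i.+1%:R^-1 in si ei; set b := j.+1%:R^-1 in sj ej.
  set gij := g (s i + s j) _ in ij *.
  rewrite (_ : e - _ = 2 * (m + a - g (s i) (s i)) + 2 * (m + b - g (s j) (s j))
    + (gij - 4 * m) + 2 * (e / 4 - a) + 2 * (e / 4 - b)); last by field.
  by do 4?apply: addr_ge0 => //; exact: mulr_ge0.
have SB u : S u -> S (u - l).
  by move=> Su; rewrite addrC -scaleN1r; exact: Slin.
have fl : f l = 1.
  apply/esym/eqP; rewrite -subr_eq0 -normr_eq0 -sqrf_eq0; apply/eqP.
  apply: (@le0_small _ _ C); rewrite ?exprn_ge0// => e /sl[N /(_ N (leqnn N)) Ne].
  have [SN fN] := Ds N.
  have -> : 1 - f l = f (s N - l).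
    by rewrite [s N - l]addrC -scaleN1r flin// fN mulN1r addrC.
  exact: le_trans (fC _ (SB _ SN)) (ler_wpM2l C0 Ne).
(* The line [s n + K z] lies in [D], so almost minimality controls [g z (s n)], while Cauchy-Schwarz
   controls [g z (s n - l)]. Each squared modulus is at most [e * g z z], whence the factor 4. *)
have lorth z : S z -> f z = 0 -> g z l = 0.
  move=> Sz fz; apply/eqP; rewrite -normr_eq0 -sqrf_eq0; apply/eqP.
  apply: (@le0_small _ _ (4 * g z z)); rewrite ?exprn_ge0 ?mulr_ge0 ?dot_ge0//.
  move=> e e0; have [N sN] := sl e e0; have [M eM] := archi_inv e0.
  pose n := maxn N M.
  have -> : g z l = g z (s n) - g z (s n - l) by rewrite linearBr /= subKr.
  apply: le_trans (ler_norm_sqrB _ _) _.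
  rewrite (_ : _ * e = 2 * (e * g z z) + 2 * (g z z * e)); last by ring.
  rewrite lerD// ler_wpM2l//.
    apply: le_trans (almost_minimal_orthogonal _ (sm n)) _.
      by move=> t; apply: mD; exact: Dtran.
    by rewrite ler_wpM2r ?dot_ge0// eM// leq_maxr.
  apply: le_trans (cauchy_schwarz _ _) _.
  by rewrite ler_wpM2l ?dot_ge0// sN// leq_maxl.
have q0 : g l l != 0.
  rewrite gt_eqF// neq0_dnorm_gt0//; apply/eqP => l0.
  by move: fl; rewrite l0 f0 => /esym/eqP; rewrite oner_eq0.
(* Since [u - f u *: l] lies in the kernel of [f], [g u l = f u * g l l], which fixes the factor. *)
exists ((g l l)^-1 *: l); first exact: SZ.
move=> u Su; rewrite linearZr_LR /= ge0_conjugation ?invr_ge0 ?dot_ge0//.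
have : g (u - f u *: l) l = 0.
  by apply: lorth; rewrite addrC -scaleNr ?flin ?fl ?mulr1 ?addNr//; exact: Slin.
rewrite linearBl /= linearZl_LR /= => /subr0_eq ->.
by rewrite mulrCA mulVf ?mulr1.
Qed.
End Dot.

(** * The graph inner product, transported to [H] along [x |-> (x, A x)] *)

Section GraphForm.
Variables (K : numFieldType) (theta : involutive_rmorphism K).
Variables (H : hilbertType theta) (A : linear_operator H).
Hypothesis domA : dom A = [set: H].

Lemma total_op_linear a u v : A (a *: u + v) = a *: A u + A v.
Proof. by apply: op_linear; rewrite domA. Qed.

(* The unused argument keeps totality of [A] available to instance inference. *)
Definition graph_form (_ : dom A = [set: H]) (x y : H) : K :=
  inner H x y + inner H (A x) (A y).

Lemma graph_form_bilinear :
  bilinear_for ( *%R ) (theta \; *%R) (graph_form domA).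
Proof.
split=> z a u v; rewrite /graph_form total_op_linear.
  by rewrite !linearDl /= !linearZl_LR /= mulrDr addrACA.
by rewrite !linearDr /= !linearZr_LR /= mulrDr addrACA.
Qed.

HB.instance Definition _ := bilinear_isBilinear.Build K H H K
  ( *%R ) (theta \; *%R) (graph_form domA) graph_form_bilinear.

Lemma graph_form_hermitian x y :
  graph_form domA x y = (-1) ^+ false * theta (graph_form domA y x).
Proof. by rewrite /graph_form hermC [X in _ + X]hermC !mul1r rmorphD. Qed.

HB.instance Definition _ := isHermitianSesquilinear.Build K H false theta
  (graph_form domA) graph_form_hermitian.

Lemma graph_formE x : graph_form domA x x = `|x| ^+ 2 + `|A x| ^+ 2.
Proof. by rewrite /graph_form !inner_norm. Qed.

Lemma graph_form_gt0 x : x != 0 -> 0 < graph_form domA x x.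
Proof.
by move=> x0; rewrite graph_formE ltr_pwDl ?exprn_ge0// exprn_gt0 ?normr_gt0.
Qed.

HB.instance Definition _ := isDotProduct.Build K H
  (graph_form domA) graph_form_gt0.

End GraphForm.

(** * Epsilon characterisations of convergence *)

Section Convergence.
Variables (K : numFieldType) (H : completeNormedModType K).

Lemma cvg_seqP (s : nat -> H) (l : H) : s n @[n --> \oo] --> l <->
  forall e, 0 < e -> exists N, forall n, (N <= n)%N -> `|s n - l| <= e.
Proof.
split=> [/cvgrPdist_le sl e /sl[N _ Ne]|sl].
  by exists N => n Nn; rewrite distrC; exact: Ne.
apply/cvgrPdist_le => e /sl[N Ne]; exists N => // n Nn /=.
by rewrite distrC; exact: Ne.
Qed.

Lemma cauchy_seq_cvg (s : nat -> H) : (forall e, 0 < e ->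
    exists N, forall n, (N <= n)%N -> `|s n - s N| <= e) ->
  exists l : H, s n @[n --> \oo] --> l.
Proof.
move=> sC; suff : cvg (s @ \oo) by move=> ?; exists (lim (s @ \oo)).
apply: cauchy_cvg; apply: cauchy_exP => e e0.
have [|N Ne] := sC (e / 2); first by rewrite divr_gt0.
exists (s N); exists N => // n Nn; rewrite -ball_normE /= distrC.
by rewrite (le_lt_trans (Ne n Nn))// ltr_pdivrMr// ltr_pMr// ltr1n.
Qed.

End Convergence.

(** * Uniform boundedness and completeness in Hilbert space *)

Section HilbertSpace.
Variables (K : numFieldType) (theta : involutive_rmorphism K).
Hypothesis mulJ : forall c, c * theta c = `|c| ^+ 2.
Hypothesis archiK : forall x : K, 0 <= x -> exists n : nat, x <= n%:R.
Variable H : hilbertType theta.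

Lemma ler_inner (x y : H) : `|inner H x y| <= `|x| * `|y|.
Proof.
rewrite -(@ler_pXn2r _ 2) ?nnegrE ?mulr_ge0// exprMn !inner_norm.
exact: cauchy_schwarz.
Qed.

(* The sign of [+- r s / |s|] is chosen so that [(z', s)] does not cancel. *)
Lemma gliding_hump_step (z s : H) (r : K) : 0 <= r ->
  exists z', `|z' - z| <= r /\ r * `|s| <= `|inner H z' s|.
Proof.
move=> r0; have [->|s0] := eqVneq s 0.
  by exists z; rewrite subrr normr0 r0 mulr0.
have sn0 : `|s| != 0 by rewrite normr_eq0.
pose x := (r / `|s|) *: s.
have xr : `|x| = r by rewrite normrZ normrM normfV normr_id divfK// ger0_norm.
have xs : inner H x s = r * `|s|.
  by rewrite linearZl_LR /= -inner_norm expr2 mulrA divfK.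
have [h|h] := real_leP (normr_real (inner H (z + x) s))
  (ger0_real (mulr_ge0 r0 (normr_ge0 s))); last first.
  by exists (z + x); rewrite addrAC subrr add0r xr; split=> //; exact: ltW.
exists (z - x); rewrite addrAC subrr add0r normrN xr; split=> //.
(* The two values differ by [2 (x, s) = 2 r |s|], so if one has modulus at most [r |s|], the other
   has at least that. *)
have : r * `|s| + r * `|s| <= `|inner H (z + x) s| + `|inner H (z - x) s|.
  apply: le_trans (ler_normB _ _).
  have -> : inner H (z + x) s - inner H (z - x) s = inner H x s *+ 2.
    by rewrite linearDl linearBl /=; ring.
  by rewrite normrMn xs ger0_norm ?mulr_ge0.
by move/(le_trans)/(_ (lerD h (lexx _))); rewrite lerD2l.
Qed.

(** Gliding hump. Were [S] unbounded, steps of length at most [3^-n] would build [z n] with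
    [(z n.+1, s n)] of modulus at least [3^-n |s n|]. Later steps are too short to cancel this, so
    the limit [l] has [|(l, s n)| > n] for every [n], against the pointwise bound at [l]. *)
Lemma uniform_boundedness (S : set H) :
  (forall z, exists M, forall s, S s -> `|inner H z s| <= M) ->
  exists C, forall s, S s -> `|s| <= C.
Proof.
move=> Sb; apply: contrapT => nC.
have /choice[s sP] (n : nat) :
    exists s, S s /\ 4 * n%:R * 3 ^+ n < `|s|.
  apply: contrapT => ns; apply: nC; exists (4 * n%:R * 3 ^+ n) => s Ss.
  rewrite real_leNgt ?ger0_real ?mulr_ge0 ?exprn_ge0//.
  by apply/negP => ?; apply: ns; exists s.
have r3 n : 0 < 3 ^- n :> K by rewrite invr_gt0 exprn_gt0.
have /choice[nxt nxtP] (p : nat * H) : exists z', `|z' - p.2| <= 3 ^- p.1 /\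
    3 ^- p.1 * `|s p.1| <= `|inner H z' (s p.1)|.
  by apply: gliding_hump_step; exact: ltW.
pose z := fix z n := if n is n'.+1 then nxt (n', z n') else 0.
have zS n : `|z n.+1 - z n| <= 3 ^- n := (nxtP (n, z n)).1.
have zs n : 3 ^- n * `|s n| <= `|inner H (z n.+1) (s n)| := (nxtP (n, z n)).2.
(* The right-hand side is the exact geometric sum of the step bounds. *)
have zD n k : `|z (n + k)%N - z n| <= 3 / 2 * (3 ^- n - 3 ^- (n + k)).
  elim: k => [|k IH]; first by rewrite addn0 !subrr normr0 mulr0.
  rewrite addnS; have -> : z (n + k).+1 - z n =
      (z (n + k).+1 - z (n + k)%N) + (z (n + k)%N - z n).
    by rewrite addrA subrK.
  apply: le_trans (ler_normD _ _) _.
  apply: le_trans (lerD (zS _) IH) _.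
  rewrite le_eqVlt; apply/orP; left; apply/eqP; rewrite exprS.
  by field; rewrite !expf_neq0 ?pnatr_eq0.
have {}zD n m : (n <= m)%N -> `|z m - z n| <= 3 / 2 * 3 ^- n.
  move=> /subnKC <-; apply: le_trans (zD _ _) _.
  by rewrite ler_pM2l ?divr_gt0// gerBl ltW.
have [|l] := @cauchy_seq_cvg _ H z.
  move=> e e0; have [N Ne] : exists N : nat, 3 / 2 / e <= N%:R.
    by apply: archiK; rewrite !divr_ge0// ltW.
  exists N => n /zD/le_trans; apply.
  rewrite ler_pdivrMr ?exprn_gt0// -ler_pdivrMl// mulrC.
  apply: le_trans Ne _.
  by rewrite -natrX ler_nat ltnW// ltn_expl.
move=> /cvg_seqP zl; have [M lM] := Sb l.
have [N MN] : exists N : nat, M <= N%:R.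
  by exact: archiK (le_trans (normr_ge0 _) (lM _ (sP 0%N).1)).
have [|m0 m0P] := zl (1 / 4 * 3 ^- N); first by rewrite mulr_gt0 ?divr_gt0.
pose m := maxn m0 N.+1.
(* Here [3/4 = 1/2 + 1/4]: the steps after [N.+1] contribute [3/2 * 3^-(N+1)], the distance from
   [z m] to [l] the rest. The remaining quarter of [3^-N |s N|] exceeds [N] because
   [|s N| > 4 N 3^N]. *)
have ls : `|inner H (z N.+1) (s N)| <=
    `|inner H l (s N)| + 3 / 4 * 3 ^- N * `|s N|.
  have -> : z N.+1 = l - ((l - z m) + (z m - z N.+1)).
    by rewrite addrA subrK subKr.
  rewrite linearBl /=; apply: le_trans (ler_normB _ _) _; rewrite lerD2l.
  apply: le_trans (ler_inner _ _) _; rewrite ler_wpM2r//.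
  apply: le_trans (ler_normD _ _) _; rewrite distrC.
  apply: le_trans (lerD (m0P m (leq_maxl _ _)) (zD _ _ (leq_maxr m0 N.+1))) _.
  rewrite le_eqVlt; apply/orP; left; apply/eqP; rewrite exprS.
  by field; rewrite !expf_neq0 ?pnatr_eq0.
have := le_trans (le_trans (zs N) ls) (lerD (lM _ (sP N).1) (lexx _)).
rewrite -lerBlDr => /le_trans/(_ MN) sN.
suff : N%:R < N%:R :> K by rewrite ltxx.
apply: lt_le_trans sN.
rewrite (_ : _ - _ = `|s N| / (4 * 3 ^+ N)); last first.
  by field; rewrite !expf_neq0 ?pnatr_eq0.
rewrite ltr_pdivlMr ?mulr_gt0 ?exprn_gt0// mulrCA mulrA.
exact: (sP N).2.
Qed.

(** Serves with [h] the identity or [A], and [q] the graph form or the inner product. *)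
Lemma norm_cauchy (W : lmodType K) (h : W -> H) (q : {dot W for theta}) s :
  (forall x y, h x - h y = h (x - y)) -> (forall x, `|h x| ^+ 2 <= q x x) ->
  dot_cauchy q s -> exists l : H, h (s n) @[n --> \oo] --> l.
Proof.
move=> hB hq sC; apply: cauchy_seq_cvg => e e0.
have [|N Ne] := sC (e ^+ 2); first by rewrite exprn_gt0.
exists N => n Nn; rewrite hB -(@ler_pXn2r _ 2) ?nnegrE// ?(ltW e0)//.
exact: le_trans (hq _) (Ne _ _ Nn (leqnn N)).
Qed.

Lemma norm_dot_cvg (s : nat -> H) (l : H) :
  s n @[n --> \oo] --> l -> dot_cvg (inner H) s l.
Proof.
move=> /cvg_seqP sl e e0.
have e1 : 0 < 1 + e by rewrite addr_gt0.
(* [e / (1 + e)] is at most both [1] and [e], so its square is at most [e]. *)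
have [|N Ne] := sl (e / (1 + e)); first by rewrite divr_gt0.
exists N => n /Ne; rewrite -inner_norm; set d := e / _ => sd.
have d1 : d <= 1 by rewrite ler_pdivrMr// mul1r lerDr.
have de : d <= e by rewrite ler_pdivrMr// ler_pMr// lerDl ltW.
rewrite expr2 -[e]mulr1; apply: ler_pM => //; first exact: le_trans de.
exact: le_trans d1.
Qed.

(** * Everywhere defined closed operators and their adjoints *)

Section ClosedOperator.
Variable A : linear_operator H.
Hypothesis domA : dom A = [set: H].

Lemma total_dom u : dom A u. Proof. by rewrite domA. Qed.

Lemma total_op0 : A 0 = 0.
Proof.
have := total_op_linear domA (-1) 0 0.
by rewrite scaler0 addr0 scaleN1r addNr.
Qed.

Lemma total_opB u v : A u - A v = A (u - v).
Proof.
by rewrite -[u - v]addrC -(scaleN1r v) total_op_linear// scaleN1r addrC.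
Qed.

(** The graph form dominates [|x|^2] and [|A x|^2], so a Cauchy sequence and its images both
    converge in [H]; closedness identifies the limit of the images as [A u]. *)
Lemma graph_form_complete : closed_operator A ->
  dot_complete (graph_form domA) setT.
Proof.
move=> A_closed s _ sC.
have [u su] : exists u : H, s n @[n --> \oo] --> u.
  apply: (@norm_cauchy _ id _ _ _ _ sC) => // x.
  by rewrite /= graph_formE lerDl exprn_ge0.
have [v sv] : exists v : H, A (s n) @[n --> \oo] --> v.
  apply: (@norm_cauchy _ A _ _ total_opB _ sC) => x.
  by rewrite /= graph_formE lerDr exprn_ge0.
have [_ Auv] := A_closed s u v (fun n => total_dom _) su sv.
exists u => // e e0; have e2 : 0 < e / 2 by rewrite divr_gt0.
have [N Ne] := norm_dot_cvg su e2; have [M Me] := norm_dot_cvg sv e2.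
exists (maxn N M) => n; rewrite geq_max => /andP[/Ne Nn /Me].
rewrite -Auv total_opB /graph_form => Mn.
by rewrite [e]splitr lerD.
Qed.

Lemma adjoint_bounded : exists2 C, 0 <= C &
  forall v w, adjoint_rel A v w -> `|w| <= C * `|v|.
Proof.
pose S := [set w | exists2 v, `|v| <= 1 & adjoint_rel A v w].
have [z|C CS] := @uniform_boundedness S.
  exists `|A z| => w [v v1 vw]; rewrite -vw; last exact: total_dom.
  by apply: le_trans (ler_inner _ _) _; rewrite ler_piMr.
have C0 : 0 <= C.
  have := CS 0; rewrite normr0; apply; exists 0; rewrite ?normr0//.
  exact: adjoint_rel0.
(* A nonzero [v] is scaled to norm 1; for [v = 0], [(w, w) = (A w, 0) = 0]. *)
exists C => // v w vw; have [v0|v0] := eqVneq v 0.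
  suff -> : w = 0 by rewrite normr0 mulr_ge0.
  apply/eqP; rewrite -normr_eq0 -sqrf_eq0 inner_norm -vw; last exact: total_dom.
  by rewrite v0 linear0r.
have nv0 : 0 < `|v| by rewrite normr_gt0.
rewrite -ler_pdivrMr// mulrC -[X in X^-1]normr_id -normfV -normrZ.
apply: CS; exists (`|v|^-1 *: v).
  by rewrite normrZ normfV normr_id mulVf ?gt_eqF.
have := adjoint_rel_linear `|v|^-1 vw (@adjoint_rel0 _ _ _ A).
by rewrite !addr0.
Qed.

(** The bound on the adjoint makes the images [t n] Cauchy along with [s n]; the identity
    [(A u, s n) = (u, t n)] then passes to the limit. *)
Lemma adjoint_dom_complete : dot_complete (inner H) (adjoint_dom A).
Proof.
move=> s /choice[t st] sC; have [C C0 AC] := adjoint_bounded.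
have [l sl] : exists l : H, s n @[n --> \oo] --> l.
  by apply: (@norm_cauchy _ id _ _ _ _ sC) => // x; rewrite inner_norm.
have stB n m : adjoint_rel A (s n - s m) (t n - t m).
  have := adjoint_rel_linear (-1) (st m) (st n).
  by rewrite !scaleN1r ![- _ + _]addrC.
have [w tw] : exists w : H, t n @[n --> \oo] --> w.
  apply: cauchy_seq_cvg => e e0.
  have C1 : 0 < C + 1 by rewrite ltr_wpDl.
  have [|N Ne] := sC ((e / (C + 1)) ^+ 2); first by rewrite exprn_gt0 ?divr_gt0.
  exists N => n Nn; apply: le_trans (AC _ _ (stB _ _)) _.
  have := Ne _ _ Nn (leqnn N).
  rewrite -inner_norm ler_pXn2r ?nnegrE ?divr_ge0 ?(ltW e0) ?(ltW C1)//.
  rewrite ler_pdivlMr// mulrC => h; apply: le_trans h.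
  by rewrite ler_wpM2r// lerDl.
exists l; last exact: norm_dot_cvg.
exists w => u Au; apply/eqP; rewrite -subr_eq0 -normr_eq0; apply/eqP.
apply: (@le0_small _ _ (`|A u| + `|u|)); rewrite ?addr_ge0// => e e0.
move/cvg_seqP: sl => /(_ e e0)[N Ne]; move/cvg_seqP: tw => /(_ e e0)[M Me].
pose n := maxn N M.
have -> : inner H (A u) l - inner H u w =
    inner H u (t n - w) - inner H (A u) (s n - l).
  by rewrite !linearBr /= (st n u Au); ring.
apply: le_trans (ler_normB _ _) _; rewrite mulrDl [leRHS]addrC.
rewrite lerD//; apply: le_trans (ler_inner _ _) _; rewrite ler_wpM2l//.
  by rewrite Me// leq_maxr.
by rewrite Ne// leq_maxl.
Qed.

Hypothesis infK : forall E : set K, E !=set0 -> (forall x, E x -> 0 <= x) ->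
  exists m, (forall x, E x -> m <= x) /\
    forall e, 0 < e -> exists2 x, E x & x <= m + e.

(* The Riesz representation of [A z |-> (A z, c)] on the graph of [A] splits
   [c] as [A u + w] with [A^* w = u]. *)
Lemma graph_decomposition c : closed_operator A ->
  exists u, adjoint_rel A (c - A u) u.
Proof.
move=> A_closed.
have [//|//|||||u _ uP] := riesz mulJ archiK infK (g := graph_form domA)
  (S := setT) (f := fun z => inner H (A z) c) (C := `|c| ^+ 2).
- exact: graph_form_complete.
- by move=> a u v _ _; rewrite total_op_linear// linearDl /= linearZl_LR.
- by rewrite exprn_ge0.
- move=> z _; apply: le_trans (_ : (`|A z| * `|c|) ^+ 2 <= _).
    by rewrite ler_pXn2r ?nnegrE ?mulr_ge0// ler_inner.
  rewrite exprMn mulrC ler_wpM2l ?exprn_ge0//= graph_formE lerDr.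
  by rewrite exprn_ge0.
(* [uP] reads [(A z, c) = (z, u) + (A z, A u)]. *)
exists u => z _; rewrite linearBr /= uP// /graph_form /=.
by rewrite addrK.
Qed.

Lemma adjoint_dom_orthogonal c : closed_operator A ->
  (forall v, adjoint_dom A v -> inner H v c = 0) -> c = 0.
Proof.
move=> A_closed cD; have [u ucP] := graph_decomposition c A_closed.
set w := c - A u in ucP.
have wc : inner H w c = 0 by apply: cD; exists u.
have wA : inner H w (A u) = inner H u u.
  rewrite (dotC (inner H)) ucP; last exact: total_dom.
  by rewrite -inner_norm ge0_conjugation ?exprn_ge0.
have : `|w| ^+ 2 + `|u| ^+ 2 = 0.
  by rewrite !inner_norm {2}/w linearBr /= wc wA sub0r addNr.
move/eqP; rewrite paddr_eq0 ?exprn_ge0// !sqrf_eq0 !normr_eq0.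
by move=> /andP[/eqP w0 /eqP u0]; move: w0; rewrite /w u0 total_op0 subr0.
Qed.

(** Riesz on the complete subspace [adjoint_dom A] yields the orthogonal projection [d] of [b]; then
    [b - d] is orthogonal to that subspace, hence zero. *)
Lemma adjoint_dom_total : closed_operator A -> adjoint_dom A = [set: H].
Proof.
move=> A_closed; apply/seteqP; split=> // b _.
have [||||||d Dd dP] := riesz mulJ archiK infK (g := inner H)
  (S := adjoint_dom A) (f := fun v => inner H v b) (C := `|b| ^+ 2).
- exact: adjoint_dom0.
- by move=> a u v; exact: adjoint_dom_linear.
- exact: adjoint_dom_complete.
- by move=> a u v _ _; rewrite linearDl /= linearZl_LR.
- by rewrite exprn_ge0.
- by move=> v _; rewrite inner_norm mulrC; exact: cauchy_schwarz.
suff /subr0_eq -> : b - d = 0 by [].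
apply: adjoint_dom_orthogonal => // v Dv.
by rewrite linearBr /= dP// subrr.
Qed.

End ClosedOperator.
End HilbertSpace.

Theorem theorem3 (R : realType) (k : scalar_kind)
  (H : hilbertType (conjugation R k)) (A : linear_operator H)
  (A_closed : closed_operator A) (domA : dom A = [set: H]%classic) :
  dom (adjoint (densely_definedT domA)) = [set: H]%classic.
Proof.
apply: adjoint_dom_total A_closed => //.
- exact: mul_conjugation.
- exact: scalar_archi.
- exact: scalar_inf.
Qed.
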